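(* Let $R$ be a finite commutative ring with $q>1$ elements, let $n$ be a positive integer, and let $f:R^n\longrightarrow R^n$ be a linear function. Then for any nonnegative integer $k$, $$f^{\lceil n\log_{2}(q)\rceil+k}(R^n)=f^{\lceil n\log_{2}(q)\rceil}(R^n).$$ If $R$ is a field, then the factor $\log_2(q)$ is not needed, that is, for any nonnegative integer $k$, $$f^{n+k}(R^n)=f^{n}(R^n).$$
   Context: Rings are not assumed to have an identity element unless stated. A linear function $R^n\to R^n$ is a homomorphism of $R$-modules. For a positive integer $m$, $f^m$ denotes the $m$-fold composition $f\circ\cdots\circ f$, and $f^m(R^n)$ denotes the image of $R^n$ under $f^m$. *)

(* Defs.v *)
From HB Require Import structures.
From mathcomp Require Import all_boot all_order all_algebra.
From mathcomp Require Import reals exp.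

Set Implicit Arguments.
Unset Strict Implicit.
Unset Printing Implicit Defensive.

Import Order.TTheory GRing.Theory Num.Theory.

Local Open Scope ring_scope.

(* MathComp's (comPz/comNz) rings all have a 1; these structures do not. *)
HB.mixin Record Zmodule_isComRng R of GRing.Zmodule R := {
  rngmul : R -> R -> R;
  rngmulA : associative rngmul;
  rngmulC : commutative rngmul;
  rngmulDl : left_distributive rngmul +%R
}.

#[short(type="comRngType")]
HB.structure Definition ComRng :=
  {R of Zmodule_isComRng R & GRing.Zmodule R}.

#[short(type="finComRngType")]
HB.structure Definition FinComRng :=
  {R of ComRng R & FinRing.Zmodule R}.

Notation "x ·r y" := (rngmul x y)
  (at level 40, left associativity, format "x  ·r  y") : ring_scope.

Definition rng_scale (R : comRngType) (n : nat) (a : R) (v : 'rV[R]_n)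
  : 'rV[R]_n := \row_(i < n) (a ·r v 0 i).

Definition rng_linear (R : comRngType) (m n : nat)
    (f : 'rV[R]_m -> 'rV[R]_n) : Prop :=
  (forall u v, f (u + v) = f u + f v) /\
  (forall a v, f (rng_scale a v) = rng_scale a (f v)).

Definition rng_is_field (R : comRngType) : Prop :=
  exists e : R,
    [/\ e != 0,
        forall x : R, e ·r x = x &
        forall x : R, x != 0 -> exists y : R, x ·r y = e].

Definition log2 (K : realType) (x : K) : K := ln x / ln 2.

(* Agrees with the integer ceiling wherever the latter is nonnegative. *)
Definition natceil (K : realType) (x : K) : nat := `|Num.ceil x|%N.

(* Main.v *)
(* The images of the iterates form a decreasing chain of subgroups of R^n which
   is stationary as soon as two consecutive terms agree.  At each strict step the
   cardinality is at least halved, and over a field it is divided by at least q;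
   since R^n has q^n elements, the chain has at most log_2 (q^n), respectively n,
   strict steps. *)

Require Import Defs.
From HB Require Import structures.
From mathcomp Require Import all_boot all_order all_algebra.
From mathcomp Require Import reals exp.

Set Implicit Arguments.
Unset Strict Implicit.
Unset Printing Implicit Defensive.

Import Order.TTheory GRing.Theory Num.Theory.

Local Open Scope ring_scope.

Section RngScale.
Variable R : comRngType.
Implicit Types a b c : R.

Lemma rngmulBl a b c : (a - b) ·r c = a ·r c - b ·r c.
Proof. by apply/eqP; rewrite eq_sym subr_eq -rngmulDl subrK. Qed.

Lemma rng_scaleBl n a b (v : 'rV[R]_n) :
  rng_scale (a - b) v = rng_scale a v - rng_scale b v.
Proof. by apply/rowP=> i; rewrite !mxE rngmulBl. Qed.

Lemma rng_scaleA n a b (v : 'rV[R]_n) :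
  rng_scale (a ·r b) v = rng_scale a (rng_scale b v).
Proof. by apply/rowP=> i; rewrite !mxE rngmulA. Qed.

Lemma rng_linearB m n (f : 'rV[R]_m -> 'rV[R]_n) :
  rng_linear f -> {morph f : u v / u - v}.
Proof.
by case=> fD _ u v; apply/eqP; rewrite eq_sym subr_eq -fD subrK.
Qed.

Lemma rng_linear_iter n (f : 'rV[R]_n -> 'rV[R]_n) i :
  rng_linear f -> rng_linear (iter i f).
Proof.
case=> fD fZ; elim: i => [|i [IHD IHZ]]; first by split.
by split=> [u v|a v] /=; rewrite ?IHD ?IHZ.
Qed.

End RngScale.

(** The translates [g i + V] lie in [W] and have [#|V|] elements each. They are pairwise disjoint: a
    common point [g i + u = g j + v] gives [g i - g j = v - u], which lies in [V]. Hence [h] is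
    injective on pairs. *)
Lemma leq_card_transversal (M : finZmodType) (I : finType) (V W : {set M})
    (g : I -> M) :
    {in W &, forall u v, u + v \in W} -> {in V &, forall u v, u - v \in V} ->
    V \subset W -> (forall i, g i \in W) ->
    (forall i j, g i - g j \in V -> i = j) ->
  (#|I| * #|V| <= #|W|)%N.
Proof.
move=> WD VB /subsetP sVW gW gV.
pose h (p : I * M) := g p.1 + p.2.
rewrite -cardsT -cardsX -(card_in_imset (f := h)).
  apply/subset_leq_card/subsetP=> _ /imsetP[[i v] /setXP[_ Vv] ->].
  by apply: WD; [apply: gW | apply: sVW].
move=> [i u] [j v] /setXP[_ Vu] /setXP[_ Vv]; rewrite /h /= => eq_h.
have eq_ij : i = j.
  apply: gV; have -> : g i - g j = v - u; last exact: VB.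
  by apply/eqP; rewrite subr_eq addrAC eq_sym subr_eq addrC eq_h addrC.
by move: eq_h; rewrite eq_ij => /addrI->.
Qed.

Section IterImage.
Variables (T : finType) (f : T -> T).

Lemma imset_iterS i : iter i.+1 f @: [set: T] = f @: (iter i f @: [set: T]).
Proof. by rewrite -imset_comp. Qed.

Lemma sub_imset_iterS i : iter i.+1 f @: [set: T] \subset iter i f @: [set: T].
Proof.
by apply/subsetP=> _ /imsetP[x _ ->]; rewrite iterSr; apply: imset_f.
Qed.

(** Each image is [f] applied to the preceding one, so one equality propagates to all later
    terms. *)
Lemma imset_iter_stable i k :
  iter i.+1 f @: [set: T] = iter i f @: [set: T] ->
  iter (i + k) f @: [set: T] = iter i f @: [set: T].
Proof.
move=> eqi; elim: k => [|k IHk]; first by rewrite addn0.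
by rewrite addnS imset_iterS IHk -imset_iterS.
Qed.

(** If the step from [m] to [m.+1] were strict, so would be all [m.+1] steps up to it, each dividing
    the cardinality by at least [c]; a set of at most [c ^ m] elements has no room for that. *)
Lemma imset_iter_stationary c m k :
    (1 < c)%N -> (0 < #|T| <= c ^ m)%N ->
    (forall i, iter i.+1 f @: [set: T] != iter i f @: [set: T] ->
      (c * #|iter i.+1 f @: [set: T]| <= #|iter i f @: [set: T]|)%N) ->
  iter (m + k) f @: [set: T] = iter m f @: [set: T].
Proof.
move=> c_gt1 /andP[T_gt0 leTc] drop; apply: imset_iter_stable.
apply/eqP/negPn/negP=> neq_m.
have neq i : (i <= m)%N -> iter i.+1 f @: [set: T] != iter i f @: [set: T].
  (* A stationary step at [i <= m] would make the images at [m] and [m.+1] both equal to the one at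
     [i]. *)
  move=> le_im; apply: contraNneq neq_m => eq_i.
  have eq_im := imset_iter_stable _ eq_i.
  by rewrite -(subnKC le_im) -addnS !eq_im.
have le_card i : (i <= m.+1)%N -> (c ^ i * #|iter i f @: [set: T]| <= #|T|)%N.
  elim: i => [|i IHi] lt_im; first by rewrite mul1n max_card.
  apply: leq_trans (IHi (ltnW lt_im)).
  by rewrite expnSr -mulnA leq_mul2l drop ?orbT ?neq.
have im_gt0 : (0 < #|iter m.+1 f @: [set: T]|)%N.
  have /card_gt0P[x _] := T_gt0.
  by apply/card_gt0P; exists (iter m.+1 f x); apply: imset_f.
(* Since the last image is nonempty, this would give [c ^ m.+1 <= c ^ m]. *)
have := leq_trans (le_card _ (leqnn _)) leTc.
apply/negP; rewrite -ltnNge; apply: leq_trans (leq_pmulr _ im_gt0).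
by rewrite ltn_exp2l.
Qed.

End IterImage.

Lemma leq_exp2_natceil_log2 (K : realType) (q n : nat) : (0 < q)%N ->
  (q ^ n <= 2 ^ natceil (n%:R * log2 (q%:R : K)))%N.
Proof.
move=> q_gt0; set m := natceil _.
have ln2_gt0 : 0 < ln (2 : K) by rewrite ln_gt0 // ltr1n.
rewrite -(ler_nat K) !natrX -ler_ln ?posrE ?exprn_gt0 ?ltr0n //.
rewrite !lnXn ?ltr0n // -[X in X <= _]mulr_natl -[X in _ <= X]mulr_natl.
rewrite -ler_pdivrMr // -mulrA.
apply: le_trans (ceil_ge _) _.
(* The absolute value in [natceil] can only enlarge the ceiling, so its sign need not be
   determined. *)
by rewrite [leRHS]pmulrn ler_int /m /natceil abszE ler_norm.
Qed.

Section LinearImage.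
Variables (R : finComRngType) (n : nat) (f : 'rV[R]_n -> 'rV[R]_n).
Hypothesis f_lin : rng_linear f.
Local Notation im i := (iter i f @: [set: 'rV[R]_n]).

Lemma im_iterB i : {in im i &, forall u v, u - v \in im i}.
Proof.
move=> _ _ /imsetP[u _ ->] /imsetP[v _ ->].
by rewrite -(rng_linearB (rng_linear_iter i f_lin)) imset_f.
Qed.

Lemma im_iterZ i a : {in im i, forall u, rng_scale a u \in im i}.
Proof.
by move=> _ /imsetP[u _ ->]; have [_ <-] := rng_linear_iter i f_lin; apply: imset_f.
Qed.

Lemma im_iter0 i : 0 \in im i.
Proof.
rewrite -(subrr (iter i f 0)) im_iterB //; exact: imset_f.
Qed.

Lemma im_iterD i : {in im i &, forall u v, u + v \in im i}.
Proof.
move=> u v Vu Vv; rewrite -[v]opprK im_iterB // -sub0r im_iterB //; exact: im_iter0.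
Qed.

Lemma im_iter_drop i : im i.+1 != im i ->
  exists2 w, w \in im i & w \notin im i.+1.
Proof.
move=> neq_im; apply/subsetPn; apply: contra neq_im => sub_im.
by rewrite eqEsubset sub_imset_iterS.
Qed.

(** For [w] in [im i] but not in [im i.+1], the elements [0] and [w] represent two distinct cosets
    of [im i.+1]. *)
Lemma leq_card_im_iter i :
  im i.+1 != im i -> (2 * #|im i.+1| <= #|im i|)%N.
Proof.
case/im_iter_drop=> w Ww nVw; rewrite -card_bool.
apply: (leq_card_transversal (g := fun b => if b then w else 0)).
- exact: im_iterD.
- exact: im_iterB.
- exact: sub_imset_iterS.
- by case; rewrite ?im_iter0.
(* The two mixed differences of representatives are [w] and [- w]; both must avoid [im i.+1]. *)
have nVNw : - w \notin im i.+1.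
  by apply: contra nVw => VNw; rewrite -[w]opprK -sub0r im_iterB ?im_iter0.
by move=> [] [] //; rewrite ?subr0 ?sub0r ?(negPf nVw) ?(negPf nVNw).
Qed.

(** Over a field all multiples of [w] lie in distinct cosets: if [(a - b) w] is in [im i.+1] with
    [a != b], scaling by the inverse [y] of [a - b] brings [w] itself into [im i.+1]. *)
Lemma leq_card_im_iter_field i : rng_is_field R ->
  im i.+1 != im i -> (#|R| * #|im i.+1| <= #|im i|)%N.
Proof.
case=> e [_ e1 e_inv] /im_iter_drop[w Ww nVw].
apply: (leq_card_transversal (g := fun a => rng_scale a w)).
- exact: im_iterD.
- exact: im_iterB.
- exact: sub_imset_iterS.
- by move=> a; apply: im_iterZ.
move=> a b; rewrite -rng_scaleBl => Vabw; apply/eqP; rewrite -subr_eq0.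
apply: contraNT nVw => /e_inv[y aby].
have -> : w = rng_scale y (rng_scale (a - b) w).
  by rewrite -rng_scaleA rngmulC aby; apply/rowP=> j; rewrite mxE e1.
exact: im_iterZ.
Qed.

End LinearImage.

Theorem theorem2p1 (K : realType) (R : finComRngType) (q : nat)
    (card_R : #|R| = q) (q_gt1 : (1 < q)%N)
    (n : nat) (n_gt0 : (0 < n)%N)
    (f : 'rV[R]_n -> 'rV[R]_n) (f_lin : rng_linear f) :
  (forall k : nat,
     iter (natceil (n%:R * log2 (q%:R : K)) + k) f @: [set: 'rV[R]_n]
     = iter (natceil (n%:R * log2 (q%:R : K))) f @: [set: 'rV[R]_n])
  /\
  (rng_is_field R ->
   forall k : nat,
     iter (n + k) f @: [set: 'rV[R]_n] = iter n f @: [set: 'rV[R]_n]).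
Proof.
have cardT : #|{: 'rV[R]_n}| = (q ^ n)%N by rewrite card_mx mul1n card_R.
have q_gt0 := ltnW q_gt1.
split=> [k|R_field k].
  apply: (@imset_iter_stationary _ _ 2) => //.
    by rewrite cardT expn_gt0 q_gt0 leq_exp2_natceil_log2.
  by move=> i; apply: leq_card_im_iter.
apply: (imset_iter_stationary (c := q)) => //.
  by rewrite cardT expn_gt0 q_gt0 leqnn.
by move=> i; rewrite -card_R; apply: leq_card_im_iter_field.
Qed.
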